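(* Let $n\ge 4$ be an integer. The hypergraph $\mathcal{H}(n,4,2|\sigma)$ with $\sigma=(2,2)$ has a gap in its $(2,2)$-spectrum.
   Context: The hypergraph $\mathcal{H}(n,4,2|\sigma)$ with $\sigma=(2,2)$ has $2n$ vertices, partitioned into $n$ classes of size $2$; its edges are the $4$-subsets of vertices whose non-zero intersection sizes with the classes form the partition $(2,2)$ of $4$, i.e. the unions of two distinct classes. For integers $2\le\alpha\le\beta\le r$, an $(\alpha,\beta)$-colouring of an $r$-uniform hypergraph is a colouring of its vertices such that the number of distinct colours appearing on every edge is at least $\alpha$ and at most $\beta$. A $k$-$(\alpha,\beta)$-colouring is an $(\alpha,\beta)$-colouring using exactly $k$ distinct colours (all $k$ are used). The $(\alpha,\beta)$-spectrum of a hypergraph is the set of all positive integers $k$ for which it has a $k$-$(\alpha,\beta)$-colouring; it has a gap if there are $k_1<k_2<k_3$ with $k_1,k_3$ in the spectrum and $k_2$ not in the spectrum. *)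

(* Defs.v *)
From mathcomp Require Import all_boot.

Set Implicit Arguments.
Unset Strict Implicit.
Unset Printing Implicit Defensive.

(* A hypergraph on the finite vertex type V is its edge set H : {set {set V}}. *)

(* The sigma-hypergraph H(n, r, q | sigma): vertex (i, j) is the j-th vertex of
   the i-th class. The partition sigma of r is a sequence of positive integers,
   considered up to permutation. *)
Definition sigma_class (n q : nat) (i : 'I_n) : {set 'I_n * 'I_q} :=
  [set v | v.1 == i].

Definition intersection_sizes (n q : nat) (E : {set 'I_n * 'I_q}) : seq nat :=
  [seq #|E :&: sigma_class q i| | i <- enum 'I_n].

Definition sigma_hypergraph (n r q : nat) (sigma : seq nat) :
    {set {set 'I_n * 'I_q}} :=
  [set E : {set 'I_n * 'I_q} | (#|E| == r) &&
           perm_eq [seq m <- intersection_sizes E | m != 0] sigma].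

Definition is_colouring (V C : finType) (H : {set {set V}})
    (alpha beta : nat) (c : V -> C) : Prop :=
  forall E : {set V}, E \in H -> alpha <= #|c @: E| <= beta.

(* Colours are named by 'I_k, so using exactly k colours means that every
   element of 'I_k is used. *)
Definition is_k_colouring (V : finType) (H : {set {set V}})
    (alpha beta k : nat) (c : V -> 'I_k) : Prop :=
  is_colouring H alpha beta c /\ c @: [set: V] = [set: 'I_k].

Definition spectrum (V : finType) (H : {set {set V}}) (alpha beta : nat)
    (k : nat) : Prop :=
  0 < k /\ exists c : V -> 'I_k, is_k_colouring H alpha beta c.

Definition has_gap (S : nat -> Prop) : Prop :=
  exists k1 k2 k3 : nat, [/\ k1 < k2, k2 < k3, S k1, ~ S k2 & S k3].

(* Main.v *)
Require Import Defs.
From mathcomp Require Import all_boot.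

(** The edges are the unions of two distinct classes. If some class carries two
    colours, every other class must reuse them, so only two colours occur; if
    all classes are monochromatic, distinct classes have distinct colours, so
    [n] colours occur. Since 2 and [n] colours are attained, 3 is a gap. *)

Lemma in_sigma_class (n q : nat) (i : 'I_n) (v : 'I_n * 'I_q) :
  (v \in sigma_class q i) = (v.1 == i).
Proof. by rewrite inE. Qed.

Lemma card_sigma_class (n q : nat) (i : 'I_n) : #|sigma_class q i| = q.
Proof.
have -> : sigma_class q i = setX [set i] [set: 'I_q].
  by apply/setP=> v; rewrite in_sigma_class !inE andbT.
by rewrite cardsX cards1 cardsT card_ord mul1n.
Qed.

Lemma card_sigma_classU (n q : nat) (i j : 'I_n) :
  i != j -> #|sigma_class q i :|: sigma_class q j| = q + q.
Proof.
move=> ij; rewrite cardsU !card_sigma_class.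
have -> : sigma_class q i :&: sigma_class q j = set0.
  apply/setP=> v; rewrite inE !in_sigma_class in_set0; apply/andP => -[/eqP->].
  exact/negP.
by rewrite cards0 subn0.
Qed.

Lemma sigma_classU_edge (n : nat) (i j : 'I_n) : i != j ->
  sigma_class 2 i :|: sigma_class 2 j \in sigma_hypergraph n 4 2 [:: 2; 2].
Proof.
move=> ij; rewrite inE card_sigma_classU //=.
set E := _ :|: _; rewrite /intersection_sizes.
have size_int l : #|E :&: sigma_class 2 l| = if l \in [set i; j] then 2 else 0.
  case: ifPn => [|/negP lE].
    rewrite -[in RHS](card_sigma_class _ 2 l) => lij; congr #|pred_of_set _|.
    apply/setIidPr; move: lij; rewrite in_set2 => /orP[]/eqP->.
      exact: subsetUl.
    exact: subsetUr.
  apply/eqP; rewrite cards_eq0; apply/eqP/setP=> v.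
  rewrite !inE; apply/andP=> -[vE /eqP vl]; case: lE.
  by rewrite in_set2 -vl.
rewrite (eq_map size_int) filter_map.
set a := preim _ _.
have -> : [seq l <- enum 'I_n | a l] = enum [set i; j].
  rewrite enumT; apply: eq_filter => l; rewrite /a /=.
  by case: (l \in _).
(* Every surviving size is [2], so the list is constant, and its length is [#|[set i; j]|], which is
   [2] because [i != j]. *)
have /all_pred1P-> : all (pred1 2)
    [seq if l \in [set i; j] then 2 else 0 | l <- enum [set i; j]].
  by apply/allP=> _ /mapP[l + ->]; rewrite mem_enum => ->.
by rewrite size_map -cardE cards2 ij.
Qed.

(** A class met in two vertices lies entirely in the edge, since classes have size 2. Two such
    classes already supply the four vertices of the edge. *)
Lemma sigma_edgeP (n : nat) (E : {set 'I_n * 'I_2}) :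
  reflect (exists2 p : 'I_n * 'I_n,
             p.1 != p.2 & E = sigma_class 2 p.1 :|: sigma_class 2 p.2)
          (E \in sigma_hypergraph n 4 2 [:: 2; 2]).
Proof.
apply: (iffP idP) => [|[[i j] /= ij ->]]; last exact: sigma_classU_edge.
(* From the permutation only the number of entries equal to [2] is kept: exactly two classes meet
   [E] in two vertices. *)
rewrite inE => /andP[/eqP E4 /permP/(_ (pred1 2))].
rewrite count_filter count_map /=.
set a := preim _ _.
have -> : count a (enum 'I_n) = #|[set l | #|E :&: sigma_class 2 l| == 2]|.
  rewrite cardE enumT -size_filter; congr size; apply: eq_filter => l.
  by rewrite /a /= inE; case: #|_| => [|[|[]]].
move=> /eqP/cards2P[i [j [ij classesE]]]; exists (i, j) => //=.
have sub l : l \in [set i; j] -> sigma_class 2 l \subset E.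
  rewrite -classesE inE => /eqP size_int; apply/setIidPr/eqP.
  by rewrite eqEcard subsetIr size_int card_sigma_class.
apply/esym/eqP; rewrite eqEcard E4 card_sigma_classU // andbT.
by rewrite subUset !sub ?set21 ?set22.
Qed.

Lemma two_in_spectrum (n : nat) : 0 < n ->
  spectrum (sigma_hypergraph n 4 2 [:: 2; 2]) 2 2 2.
Proof.
(* Colouring by position inside the class puts both colours on every class. *)
move=> n_gt0; split=> //; exists snd; split.
  move=> _ /sigma_edgeP[[i j] /= _ ->].
  suff -> : snd @: (sigma_class 2 i :|: sigma_class 2 j) = [set: 'I_2].
    by rewrite cardsT card_ord.
  apply/setP=> x; rewrite inE; apply/imsetP; exists (i, x) => //.
  by rewrite inE !in_sigma_class eqxx.
apply/setP=> x; rewrite inE; apply/imsetP.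
by exists (Ordinal n_gt0, x).
Qed.

Lemma n_in_spectrum (n : nat) : 0 < n ->
  spectrum (sigma_hypergraph n 4 2 [:: 2; 2]) 2 2 n.
Proof.
(* Colouring by class index makes each class monochromatic in a colour of its own. *)
move=> n_gt0; split=> //; exists fst; split.
  move=> _ /sigma_edgeP[[i j] /= ij ->].
  suff -> : fst @: (sigma_class 2 i :|: sigma_class 2 j) = [set i; j].
    by rewrite cards2 ij.
  apply/setP=> x; rewrite in_set2; apply/imsetP/idP.
    by move=> [v + ->]; rewrite inE !in_sigma_class.
  by move=> xij; exists (x, ord0) => //; rewrite inE !in_sigma_class.
apply/setP=> x; rewrite inE; apply/imsetP.
by exists (x, ord0).
Qed.

Lemma spectrum_le2_or_ge (n k : nat) :
  spectrum (sigma_hypergraph n 4 2 [:: 2; 2]) 2 2 k -> k <= 2 \/ n <= k.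
Proof.
move=> [_ [c [col surj]]].
have two (i j : 'I_n) : i != j ->
    #|c @: (sigma_class 2 i :|: sigma_class 2 j)| = 2.
  by move=> /sigma_classU_edge/col; rewrite -eqn_leq => /eqP.
(* In ['I_2], [ord0] and [ord_max] are the two positions, so the test asks whether some class
   carries two colours. *)
have [/existsP[i bichrom]|/existsPn monochrom] :=
    boolP [exists i : 'I_n, c (i, ord0) != c (i, ord_max)].
  left; rewrite -[k]card_ord -cardsT -surj.
  set P := [set c (i, ord0); c (i, ord_max)].
  have cardP : #|P| = 2 by rewrite cards2 bichrom.
  suff: #|c @: [set: 'I_n * 'I_2]| <= #|P| by rewrite cardP.
  apply: subset_leq_card; apply/subsetP=> _ /imsetP[[j y] _ ->].
  have [<-|ij] := eqVneq i j.
    case: y => [[|[|//]] y_lt]; rewrite in_set2; apply/orP; [left|right];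
      by apply/eqP; congr (c (_, _)); apply: val_inj.
  (* The two colours of class [i] exhaust the two colours allowed on its union with class [j], so
     class [j] brings no new one. *)
  suff -> : P = c @: (sigma_class 2 i :|: sigma_class 2 j).
    by apply: imset_f; rewrite inE !in_sigma_class /= eqxx orbT.
  apply/eqP; rewrite eqEcard cardP two // andbT subUset !sub1set.
  by rewrite !imset_f // inE in_sigma_class /= eqxx.
right; have mono (v : 'I_n * 'I_2) : c v = c (v.1, ord0).
  case: v => i [[|[|//]] y_lt] /=.
    by congr (c (_, _)); apply: val_inj.
  have /negPn/eqP-> := monochrom i.
  by congr (c (_, _)); apply: val_inj.
(* Two distinct monochromatic classes of the same colour would form an edge with one colour only.
   Injectivity then gives at least [n] colours. *)
have inj : injective (fun i : 'I_n => c (i, ord0)).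
  move=> i j eq_c; apply/eqP; apply: contraT => /two card2.
  suff: #|c @: (sigma_class 2 i :|: sigma_class 2 j)| <= #|[set c (i, ord0)]|.
    by rewrite card2 cards1.
  apply: subset_leq_card; apply/subsetP=> _ /imsetP[v + ->].
  by rewrite in_setU !in_sigma_class in_set1 mono => /orP[]/eqP->; rewrite ?eq_c.
by have := leq_card _ inj; rewrite !card_ord.
Qed.

Theorem theorem4p1 (n : nat) (hn : 4 <= n) :
  has_gap (spectrum (sigma_hypergraph n 4 2 [:: 2; 2]) 2 2).
Proof.
have n_gt0 : 0 < n by apply: leq_trans hn.
exists 2, 3, n; split=> //; [exact: two_in_spectrum | | exact: n_in_spectrum].
by move=> /spectrum_le2_or_ge[|n_le3] //; have := leq_trans hn n_le3.
Qed.
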